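(* Let $\mathcal{G}=(\mathcal{N},\mathcal{E})$ be the velocity graph built from an ordered set of $N\ge 2$ waypoints with $M$ sampled velocities at each intermediate waypoint. Then the number of nodes is $$|\mathcal{N}| = (N-2)M+2,$$ and, for $N>2$, the number of edges is $$|\mathcal{E}| = (N-3)M^2+2M.$$
   Context: Velocity graph: let $\mathcal{W}=\{w_1,\dots,w_N\}\subset\mathbb{R}^3$ be an ordered list of waypoints. At each intermediate waypoint $w_i$ ($2\le i\le N-1$) a set of $M$ distinct velocities in $\mathbb{R}^3$ is sampled. At $w_1$ and at $w_N$ there is a single prescribed velocity (start and goal conditions). The nodes of $\mathcal{G}$ are the pairs (waypoint, velocity): one start node at $w_1$, one goal node at $w_N$, and $M$ nodes at each intermediate waypoint; nodes at different waypoint indices are different. There is exactly one (directed) edge from each node at waypoint $w_i$ to each node at the next waypoint $w_{i+1}$, for $1\le i\le N-1$, and no other edges. (Each edge represents the minimum-time double-integrator trajectory connecting the two position-velocity states; no edges are removed for collisions or state constraints.) *)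

(* Defs.v *)
From HB Require Import structures.
From mathcomp Require Import all_boot all_order all_algebra finmap reals.

Set Implicit Arguments.
Unset Strict Implicit.
Unset Printing Implicit Defensive.

Local Open Scope fset_scope.

Record digraph (T : choiceType) := Digraph {
  nodes : {fset T};
  edges : {fset T * T}
}.

(* A node carries its waypoint index next to its (position, velocity) state, so
   that nodes at different indices differ even when two waypoints coincide.
   The indices are 0-based: w_1 has index 0 and w_N has index N - 1. *)
Definition vnode (R : realType) (N : nat) : choiceType :=
  ('I_N * ('rV[R]_3 * 'rV[R]_3))%type.

Section VelocityGraph.
Variables (R : realType) (N : nat).
Variable w : N.-tuple 'rV[R]_3.
Variables vstart vgoal : 'rV[R]_3.
(* Only the values of [samples] at the intermediate indices are used. *)
Variable samples : 'I_N -> {fset 'rV[R]_3}.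

Definition velocities (i : 'I_N) : {fset 'rV[R]_3} :=
  if val i == 0 then [fset vstart]
  else if val i == N.-1 then [fset vgoal]
  else samples i.

Definition vgraph_nodes : {fset vnode R N} :=
  [fset ((i, (tnth w i, v)) : vnode R N) | i in 'I_N, v in velocities i].

Definition vgraph_edges : {fset vnode R N * vnode R N} :=
  [fset e in vgraph_nodes `*` vgraph_nodes | val e.2.1 == (val e.1.1).+1].

Definition velocity_graph : digraph (vnode R N) :=
  Digraph vgraph_nodes vgraph_edges.

End VelocityGraph.

(* Main.v *)
Require Import Defs.
From mathcomp Require Import all_boot all_order all_algebra finmap reals.

(** The index is a bare natural number rather than an ordinal, so that the counts become range sums
    whose first and last terms can be split off. *)
Definition layer_size (N M k : nat) : nat :=
  if (k == 0) || (k == N.-1) then 1 else M.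

Lemma card_velocities (R : realType) (N M : nat) (vstart vgoal : 'rV[R]_3)
    (samples : 'I_N -> {fset 'rV[R]_3}%fset) :
  (forall i : 'I_N, 0 < i < N.-1 -> #|` samples i|%fset = M) ->
  forall i : 'I_N,
    #|` velocities vstart vgoal samples i|%fset = layer_size N M i.
Proof.
move=> samplesM i; rewrite /velocities /layer_size.
case: eqVneq => [_|i0] /=; first exact: cardfs1.
case: eqVneq => [_|iN] /=; first exact: cardfs1.
apply: samplesM; rewrite lt0n i0 ltn_neqAle iN /=.
by rewrite -ltnS (ltn_predK (ltn_ord i)).
Qed.

Section Counting.
Variables (R : realType) (N M : nat) (w : N.-tuple 'rV[R]_3).
Variables (vstart vgoal : 'rV[R]_3) (samples : 'I_N -> {fset 'rV[R]_3}%fset).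
Hypothesis samplesM :
  forall i : 'I_N, 0 < i < N.-1 -> #|` samples i|%fset = M.

Let Nodes := vgraph_nodes w vstart vgoal samples.

(* Since the index is a component of a node, summing over the nodes a quantity
   that depends only on the index amounts to weighting the indices by the layer
   sizes; the node count takes the quantity 1, and the edge count applies this
   twice, once per endpoint. *)
Lemma sum_vgraph_nodes (F : 'I_N -> nat) :
  \sum_(x <- Nodes) F x.1 = \sum_(i < N) layer_size N M i * F i.
Proof.
(* Distinct pairs of index and velocity give distinct nodes, even when waypoints coincide, so the
   sum over the image is an iterated sum. *)
rewrite big_imfset2 /=; last first.
  move=> [i v] [j u] _ _ /= E.
  by move: (congr1 fst E) (congr1 (fun x => x.2.2) E) => /= -> ->.
rewrite /index_enum -enumT; apply: eq_bigr => i _.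
rewrite big_const_seq count_predT iter_addn_0 mulnC.
by rewrite -(@card_velocities _ _ _ vstart vgoal _ samplesM).
Qed.

Lemma card_vgraph_nodes :
  #|` Nodes|%fset = \sum_(0 <= k < N) layer_size N M k.
Proof.
rewrite card_fset_sum1 (sum_vgraph_nodes (fun=> 1)) big_mkord.
by apply: eq_bigr => i _; rewrite muln1.
Qed.

(** The number of edges leaving a node depends only on its index: it is the size of the next layer.
    The last layer has no next one, hence the bound [N.-1]. *)
Lemma card_vgraph_edges :
  #|` vgraph_edges w vstart vgoal samples|%fset =
  \sum_(0 <= k < N.-1) layer_size N M k * layer_size N M k.+1.
Proof.
rewrite card_fset_sum1 big_fset /= big_mkcond big_imfset2 /=; last first.
  move=> [x y] [x' y'] _ _ /= E.
  by move: (congr1 fst E) (congr1 snd E) => /= -> ->.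
(* The out-degree of a node of index [i], with adjacency of layers encoded as a 0/1 weight. *)
pose succs (i : 'I_N) := \sum_(j < N) layer_size N M j * (val j == i.+1).
rewrite (eq_bigr (fun x : vnode R N => succs x.1)); last first.
  move=> x _.
  rewrite -[RHS](sum_vgraph_nodes (fun j => (val j == x.1.+1) : nat)).
  by apply: eq_bigr => y _; case: eqP.
rewrite sum_vgraph_nodes.
have succsE (i : 'I_N) :
    succs i = if i < N.-1 then layer_size N M i.+1 else 0.
  rewrite /succs; case: ifPn => iN; last first.
    apply: big1 => j _; case: eqP => [ji|_]; last by rewrite muln0.
    by case/negP: iN; rewrite ltn_predRL -ji ltn_ord.
  have iN' : i.+1 < N by rewrite -ltn_predRL.
  rewrite (bigD1 (Ordinal iN')) //= eqxx muln1 big1 ?addn0 // => j.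
  by rewrite -val_eqE /= => /negPf ->; rewrite muln0.
rewrite big_mkord.
(* The right-hand sum is extended to all indices below [N], guarded by [i < N.-1], to match the left
   one term by term. *)
rewrite (big_ord_widen _ (fun k => layer_size N M k * layer_size N M k.+1)
           (leq_pred N)).
rewrite [RHS]big_mkcond.
by apply: eq_bigr => i _; rewrite succsE; case: ifP; rewrite ?muln0.
Qed.

End Counting.

Lemma layer_size_inner (N M k : nat) : 0 < k < N.-1 -> layer_size N M k = M.
Proof.
by case/andP=> k0 kN; rewrite /layer_size (gtn_eqF k0) (ltn_eqF kN).
Qed.

Lemma layer_size_first (N M : nat) : layer_size N M 0 = 1.
Proof. by []. Qed.

Lemma layer_size_last (N M : nat) : layer_size N M N.-1 = 1.
Proof. by rewrite /layer_size eqxx orbT. Qed.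

Theorem proposition1 (R : realType) (N M : nat)
    (w : N.-tuple 'rV[R]_3) (vstart vgoal : 'rV[R]_3)
    (samples : 'I_N -> {fset 'rV[R]_3}%fset) :
  2 <= N ->
  (forall i : 'I_N, 0 < i < N.-1 -> #|` samples i|%fset = M) ->
  let G := velocity_graph w vstart vgoal samples in
  #|` nodes G|%fset = (N - 2) * M + 2 /\
  (2 < N -> #|` edges G|%fset = (N - 3) * M ^ 2 + 2 * M).
Proof.
move=> N2 samplesM G.
rewrite (card_vgraph_nodes _ _ _ w vstart vgoal _ samplesM).
rewrite (card_vgraph_edges _ _ _ w vstart vgoal _ samplesM).
case: N N2 {w samples samplesM G} => [|[|n]] // _; split.
  (* Here [N = n.+2]: the two end layers contribute 1 each and the [n] inner layers [M] each. *)
  rewrite big_nat_recl // big_nat_recr //= layer_size_first.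
  rewrite (layer_size_last n.+2) (eq_big_nat _ _ (F2 := fun=> M)).
    by rewrite sum_nat_const_nat !subSS !subn0 addnCA.
  by move=> k kn; rewrite layer_size_inner.
case: n => [|n] // _.
(* Here [N = n.+3]: the two outer terms pair an end node with a layer of size [M], and the [n] terms
   between pair two inner layers. *)
rewrite big_nat_recl // big_nat_recr //= layer_size_first.
rewrite (layer_size_last n.+3) !layer_size_inner ?ltnSn //.
rewrite (eq_big_nat _ _ (F2 := fun=> M ^ 2)).
  rewrite sum_nat_const_nat !subSS !subn0 mul1n muln1.
  by rewrite addnCA addnn mul2n.
by move=> k kn; rewrite !layer_size_inner ?ltnS ?(ltnW kn) //.
Qed.
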